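(* For any $a > 0$ and any $\alpha > 1$, there exists an integer $n(a,\alpha)$ such that, for every integer $n \ge n(a,\alpha)$, the fractional Ornstein--Uhlenbeck field on $\mathcal{L}_n$ with covariance \[ G(x,y) = \exp\bigl( -a\, d(x,y)^\alpha \bigr) \] does not exist; that is, the kernel $G$ is not positive semidefinite on $\mathcal{L}_n \times \mathcal{L}_n$.
   Context: Let $\ell^2 = \ell^2(\{0,1,2,\ldots\})$ be the real Hilbert space of square-summable sequences, with Lorentz form $[x,y] := x_0 y_0 - \sum_{j=1}^\infty x_j y_j$. Lobachevsky space is $\mathcal{L} := \{x \in \ell^2 : x_0 > 0 \text{ and } [x,x] = 1\}$; for $x,y \in \mathcal{L}$ one has $[x,y] \ge 1$, and the hyperbolic metric is $d(x,y) := \operatorname{arcosh}[x,y]$. Finite-dimensional real hyperbolic space is $\mathcal{L}_n := \{x \in \mathcal{L} : x_j = 0 \text{ for all } j \ge n\}$. A symmetric kernel $G : X \times X \to \mathbb{R}$ is positive semidefinite if the matrix $[G(x(i),x(j))]_{i,j=1}^m$ is positive semidefinite for every $m \geq 1$ and all $x(1), \ldots, x(m) \in X$. A (Gaussian) random field on $X$ with covariance $G$ exists if and only if $G$ is positive semidefinite. *)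

(* Defs.v *)
From mathcomp Require Import all_boot all_order all_algebra.
From mathcomp Require Import all_classical all_reals all_analysis.
From mathcomp Require Import ring lra.

Set Implicit Arguments.
Unset Strict Implicit.
Unset Printing Implicit Defensive.

Import Order.TTheory GRing.Theory Num.Theory.
Import numFieldNormedType.Exports.

Local Open Scope classical_set_scope.
Local Open Scope ring_scope.

Definition ell2 (R : realType) : set (R^nat) :=
  [set x : R^nat | cvgn (series (fun j => x j ^+ 2))].
Arguments ell2 : clear implicits.

(* The series is the limit of its real partial sums; it converges absolutely
   when x and y are in ell2. *)
Definition lorentz (R : realType) (x y : R^nat) : R :=
  x 0%N * y 0%N - limn (fun n => \sum_(1 <= j < n) x j * y j).

Definition lobachevsky (R : realType) : set (R^nat) :=
  [set x : R^nat | [/\ ell2 R x, 0 < x 0%N & lorentz x x = 1]].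
Arguments lobachevsky : clear implicits.

Definition lobachevsky_fin (R : realType) (n : nat) : set (R^nat) :=
  [set x : R^nat | lobachevsky R x /\ forall j, (n <= j)%N -> x j = 0].
Arguments lobachevsky_fin : clear implicits.

(* Only meaningful for 1 <= t; see arcosh_ge0 and arcoshK. *)
Definition arcosh (R : realType) (t : R) : R :=
  ln (t + Num.sqrt (t ^+ 2 - 1)).

Lemma arcosh_ge0 (R : realType) (t : R) : 1 <= t -> 0 <= arcosh t.
Proof.
by move=> t1; apply: ln_ge0; apply: (le_trans t1); rewrite lerDl sqrtr_ge0.
Qed.

Lemma arcoshK (R : realType) (t : R) : 1 <= t ->
  (expR (arcosh t) + expR (- arcosh t)) / 2 = t.
Proof.
move=> t1.
have s0 : 0 <= Num.sqrt (t ^+ 2 - 1) by exact: sqrtr_ge0.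
have sE : Num.sqrt (t ^+ 2 - 1) ^+ 2 = t ^+ 2 - 1.
  by rewrite sqr_sqrtr // subr_ge0 exprn_ege1.
rewrite expRN /arcosh lnK; last by rewrite posrE; lra.
move: s0 sE; set s := Num.sqrt _ => s0 sE.
have -> : (t + s)^-1 = t - s.
  have ts0 : t + s != 0 by rewrite gt_eqF//; lra.
  apply: (mulfI ts0); rewrite divff// mulrC -subr_sqr sE; ring.
by field.
Qed.

Definition hdist (R : realType) (x y : R^nat) : R := arcosh (lorentz x y).

Definition psd_mx (R : realType) (m : nat) (A : 'M[R]_m) : Prop :=
  forall c : 'cV[R]_m, 0 <= (c^T *m A *m c) 0 0.

(* Intended for kernels symmetric on X; fou_covC gives the symmetry of the
   kernel used below. *)
Definition psd_kernel (R : realType) (T : Type) (X : set T)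
    (G : T -> T -> R) : Prop :=
  forall (m : nat) (p : 'I_m -> T), (1 <= m)%N -> (forall i, X (p i)) ->
    psd_mx (\matrix_(i < m, j < m) G (p i) (p j)).

(* Since 0 `^ alpha = 0 for alpha != 0, the value at hdist x y = 0 is 1. *)
Definition fou_cov (R : realType) (a alpha : R) (x y : R^nat) : R :=
  expR (- (a * hdist x y `^ alpha)).

Lemma fou_covC (R : realType) (a alpha : R) (x y : R^nat) :
  fou_cov a alpha x y = fou_cov a alpha y x.
Proof.
rewrite /fou_cov /hdist /lorentz [x 0%N * _]mulrC.
by under eq_fun do under eq_bigr do rewrite mulrC.
Qed.

(* Main.v *)
(** In high dimension one can place [o = (1, 0, ...)] and the many points
    [x_i = (c, s e_i)] with [c ^+ 2 - s ^+ 2 = 1], so that [[o, x_i] = c] and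
    [[x_i, x_j] = c ^+ 2] for [i != j].  If [F ([x, y])] is positive
    semidefinite with [F 1 = 1], pairing [o] with the average of [M] points
    [x_i] and letting [M] grow gives [F c ^+ 2 <= F (c ^+ 2)].  For
    [F = exp (- a arcosh ^ alpha)] this reads
    [arcosh (c ^+ 2) ^ alpha <= 2 arcosh c ^ alpha], which fails for large [c]
    because [arcosh (c ^+ 2) / arcosh c] tends to [2] and [2 < 2 ^ alpha]. *)
Require Import Defs.
From mathcomp Require Import all_boot all_order all_algebra.
From mathcomp Require Import all_classical all_reals all_analysis.
From mathcomp Require Import ring lra.

Import Order.TTheory GRing.Theory Num.Theory.
Local Open Scope ring_scope.

(** With [c = 1] and [s = 0] this is the base point [o] for any positive [i], so one product formula
    serves [o] and all the [x_i]. *)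
Definition axis_point {R : realType} (c s : R) (i : nat) : R^nat :=
  fun j => if j == 0%N then c else if j == i then s else 0.

Lemma sum_axis_point {R : realType} (c s c' s' : R) (i i' n : nat) :
  (0 < i < n)%N ->
  \sum_(1 <= j < n) axis_point c s i j * axis_point c' s' i' j =
  if i == i' then s * s' else 0.
Proof.
move=> i0n.
under eq_big_nat => j /andP[j0 _].
  rewrite /axis_point gtn_eqF//.
  rewrite (_ : _ * _ = if j == i then (if i == i' then s * s' else 0) else 0).
    over.
  by case: (eqVneq j i) => [->|_]; rewrite ?mul0r//; case: eqP; rewrite ?mulr0.
by rewrite -big_mkcond big_nat1_eq i0n.
Qed.

Lemma lorentz_axis_point {R : realType} (c s c' s' : R) (i i' : nat) :
  (0 < i)%N ->
  lorentz (axis_point c s i) (axis_point c' s' i') =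
  c * c' - (if i == i' then s * s' else 0).
Proof.
move=> i0; rewrite /lorentz; congr (_ - _).
(* The partial sums are constant as soon as they include the coordinate [i]. *)
apply/cvg_lim => //; apply: cvg_near_cst.
exists i.+1 => // n /= ltin.
by rewrite sum_axis_point // i0 ltin.
Qed.

Lemma axis_point_lobachevsky_fin {R : realType} (c s : R) (i n : nat) :
  (0 < i < n)%N -> 0 < c -> c ^+ 2 - s ^+ 2 = 1 ->
  lobachevsky_fin R n (axis_point c s i).
Proof.
move=> /andP[i0 ltin] c0 cs; split; last first.
  move=> j lenj; rewrite /axis_point !gtn_eqF //.
    exact: leq_trans ltin lenj.
  exact: leq_trans (leq_ltn_trans (leq0n i) ltin) lenj.
split=> //; last by rewrite lorentz_axis_point // eqxx -!expr2.
apply: (@is_cvg_near_cst _ _ (c ^+ 2 + s ^+ 2)).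
exists i.+1 => // k /= ltik.
rewrite /series /= big_ltn; last exact: leq_ltn_trans ltik.
congr (_ + _); under eq_bigr do rewrite expr2.
by rewrite sum_axis_point ?i0 // eqxx expr2.
Qed.

(** This is Cauchy-Schwarz for a fixed number [M = m.+1] of points: the average of the [x_i] has
    variance [(1 + m * F (c ^+ 2)) / M] and covariance [F c] with [o], which has variance 1. *)
Lemma psd_lorentz_kernel {R : realType} (F : R -> R) (n m : nat) (c : R) :
  F 1 = 1 -> (m.+1 < n)%N -> 1 <= c ->
  psd_kernel (lobachevsky_fin R n) (fun x y => F (lorentz x y)) ->
  m.+1%:R * F c ^+ 2 <= 1 + m%:R * F (c ^+ 2).
Proof.
move=> F1 ltmn c1 psdF.
pose s := Num.sqrt (c ^+ 2 - 1).
have sE : s ^+ 2 = c ^+ 2 - 1 by rewrite sqr_sqrtr // subr_ge0 exprn_ege1.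
(* Index 0 carries [o]; the shift [k.+1] keeps the [x_i] off the time coordinate, and [m.+1 < n]
   makes room for all of them. *)
pose p (i : 'I_m.+2) : R^nat :=
  if unlift ord0 i is Some k then axis_point c s k.+1 else axis_point 1 0 1.
have pX i : lobachevsky_fin R n (p i).
  rewrite /p; case: unliftP => [k _|_]; apply: axis_point_lobachevsky_fin.
  - by rewrite /= (leq_ltn_trans (ltn_ord k)).
  - by lra.
  - by rewrite sE; ring.
  - by rewrite /= (leq_ltn_trans _ ltmn).
  - by [].
  - by ring.
have M0 : 0 < m.+1%:R :> R by rewrite ltr0n.
(* With weight 1 on each [x_i], the weight [t] of [o] enters as [t ^+ 2 + 2 * t * M * F c], minimal
   at [t = - (M * F c)]. *)
pose v : 'cV[R]_m.+2 :=
  \col_i (if unlift ord0 i is Some _ then 1 else - (m.+1%:R * F c)).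
have := psdF _ _ (ltn0Sn _) pX v.
have p00 : F (lorentz (p ord0) (p ord0)) = 1.
  by rewrite /p unlift_none lorentz_axis_point //= !mulr1 mulr0 subr0.
have p0l k : F (lorentz (p ord0) (p (lift ord0 k))) = F c.
  rewrite /p unlift_none liftK lorentz_axis_point // mul1r mul0r.
  by rewrite if_same subr0.
have pl0 k : F (lorentz (p (lift ord0 k)) (p ord0)) = F c.
  rewrite /p unlift_none liftK lorentz_axis_point // mulr1 mulr0.
  by rewrite if_same subr0.
have pll k l : F (lorentz (p (lift ord0 k)) (p (lift ord0 l))) =
    F (c ^+ 2) + (if l == k then 1 - F (c ^+ 2) else 0).
  rewrite /p !liftK lorentz_axis_point // eqSS val_eqE [k == l]eq_sym -!expr2.
  case: eqP => _; last by rewrite subr0 addr0.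
  by rewrite sE opprB addrC subrK F1 addrC subrK.
rewrite mxE big_ord_recl.
have -> : \sum_(j < m.+1) (v^T *m \matrix_(i, j) F (lorentz (p i) (p j)))
    0 (lift ord0 j) * v (lift ord0 j) 0 =
    m.+1%:R * (- (m.+1%:R * F c) * F c + (1 + m%:R * F (c ^+ 2))).
  transitivity (\sum_(l < m.+1)
      (- (m.+1%:R * F c) * F c + (1 + m%:R * F (c ^+ 2)))); last first.
    by rewrite sumr_const card_ord [RHS]mulr_natl.
  apply: eq_bigr => l _; rewrite !mxE liftK mulr1 big_ord_recl !mxE unlift_none.
  rewrite p0l; congr (_ + _).
  under eq_bigr do rewrite !mxE liftK pll mul1r.
  rewrite big_split /= sumr_const card_ord -big_mkcond /=.
  under eq_bigl do rewrite eq_sym.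
  by rewrite big_pred1_eq mulrS -mulr_natl; ring.
(* The column of [o] contributes 0 for this weight, so the form equals [M] times the difference of
   the two sides of the claim. *)
rewrite !mxE big_ord_recl !mxE unlift_none p00.
under eq_bigr do rewrite !mxE liftK pl0 mul1r.
rewrite sumr_const card_ord -[F c *+ _]mulr_natl.
set M := m.+1%:R in M0 *; move=> h.
rewrite -subr_ge0 -(pmulr_rge0 _ M0); apply: le_trans h _.
by rewrite le_eqVlt; apply/orP; left; apply/eqP; ring.
Qed.

(** As [t + sqrt (t ^+ 2 - 1)] lies between [t] and [2 * t], this bound and the next one locate
    [arcosh t] within [ln 2] of [ln t]. *)
Lemma arcosh_ge_ln {R : realType} (t : R) : 1 <= t -> ln t <= arcosh t.
Proof.
move=> t1; have s0 := sqrtr_ge0 (t ^+ 2 - 1).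
by rewrite /arcosh ler_ln ?posrE; lra.
Qed.

Lemma arcosh_le_ln {R : realType} (t : R) : 1 <= t -> arcosh t <= ln t + ln 2.
Proof.
move=> t1; have s0 := sqrtr_ge0 (t ^+ 2 - 1).
have st : Num.sqrt (t ^+ 2 - 1) <= t.
  rewrite -[leRHS]ger0_norm; last lra.
  by rewrite -sqrtr_sqr ler_wsqrtr //; lra.
by rewrite -lnM ?posrE; [rewrite /arcosh ler_ln ?posrE; lra|lra|lra].
Qed.

Lemma arcosh_sqr_gt {R : realType} (alpha : R) : 1 < alpha ->
  exists2 c, 1 <= c & 2 * arcosh c `^ alpha < arcosh (c ^+ 2) `^ alpha.
Proof.
move=> alpha1; pose b : R := 2 `^ alpha^-1.
have b0 : 0 < b by rewrite powR_gt0.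
have l20 : 0 < ln 2 :> R by rewrite ln_gt0; lra.
have b2 : b < 2.
  rewrite -[ltRHS](@lnK R) ?posrE // /b /powR pnatr_eq0 /= ltr_expR.
  by rewrite gtr_pMl // invf_lt1; lra.
have bE : b `^ alpha = 2 by rewrite -powRrM mulVf ?powRr1 //; lra.
have d0 : 0 < 2 - b by lra.
(* Chosen so that [2 * L - b * (L + ln 2)] is exactly 1. *)
pose L := (b * ln 2 + 1) / (2 - b).
have L0 : 0 < L by rewrite divr_gt0 // addr_gt0 // mulr_gt0.
have LE : L * (2 - b) = b * ln 2 + 1 by rewrite mulfVK // gt_eqF.
have c1 : 1 <= expR L by rewrite ltW // expR_gt1.
exists (expR L) => //.
have A0 := arcosh_ge0 c1.
have c21 : 1 <= expR L ^+ 2 by rewrite exprn_ege1.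
rewrite -[X in X * _]bE -powRM // ?(ltW b0) //.
have := arcosh_le_ln _ c1; rewrite expRK => A1.
have := arcosh_ge_ln _ c21; rewrite lnXn ?expR_gt0 // expRK mulr2n => A2.
have bA := ler_wpM2l (ltW b0) A1.
have lt_arcosh : b * arcosh (expR L) < arcosh (expR L ^+ 2).
  apply: le_lt_trans bA _; apply: lt_le_trans A2.
  by clearbody L; lra.
apply: gt0_ltr_powR lt_arcosh; rewrite ?nnegrE.
- exact: lt_trans ltr01 alpha1.
- by rewrite mulr_ge0 // ltW.
- exact: arcosh_ge0.
Qed.

Theorem proposition3p9 (R : realType) (a alpha : R)
    (ha : 0 < a) (halpha : 1 < alpha) :
  exists N : nat, forall n : nat, (N <= n)%N ->
    ~ psd_kernel (lobachevsky_fin R n) (fou_cov a alpha).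
Proof.
have [c c1 hc] := arcosh_sqr_gt _ halpha.
pose F (t : R) := expR (- (a * arcosh t `^ alpha)).
have F1 : F 1 = 1.
  rewrite /F /arcosh expr1n subrr sqrtr0 addr0 ln1 powR0.
    by rewrite mulr0 oppr0 expR0.
  by rewrite gt_eqF // (lt_trans ltr01 halpha).
have gap : F (c ^+ 2) < F c ^+ 2.
  by rewrite /F -expRM_natl ltr_expR mulrN mulrCA ltrN2 ltr_pM2l.
have d0 : 0 < F c ^+ 2 - F (c ^+ 2) by rewrite subr_gt0.
(* The kernel inequality rearranges to [m * (F c ^+ 2 - F (c ^+ 2)) <= 1 - F c ^+ 2 <= 1], which
   this [m] violates. *)
pose m := Num.bound (F c ^+ 2 - F (c ^+ 2))^-1.
have hm : 1 < m%:R * (F c ^+ 2 - F (c ^+ 2)).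
  rewrite -ltr_pdivrMr // div1r; apply: archi_boundP.
  by rewrite invr_ge0 ltW.
(* One time coordinate and [m.+1] spatial ones are needed. *)
exists m.+2 => n ltmn psdF.
have := psd_lorentz_kernel F n m c F1 ltmn c1 psdF.
rewrite -natr1; move: (sqr_ge0 (F c)) hm.
by move: (F c ^+ 2) (F (c ^+ 2)) m%:R => u v w; clear -u; lra.
Qed.
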